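(* For all $k\ge 1$ and all $n\ge j\ge 1$, $$N(n,j,k)=\sum_{i=0}^{n-j}N(n-j,i,k-1)\binom{2n-j-i}{2n-2j},$$ equivalently $$N(n,j,k)=\sum_{i=0}^{n-j}N(n-j,n-j-i,k-1)\binom{n+i}{2n-2j}.$$
   Context: An ordered tree is a rooted tree in which the children of each vertex are linearly ordered; its height is the maximum distance from a vertex to the root, and a leaf is a vertex with no children. For integers $n,j,k\ge 0$, $N(n,j,k)$ denotes the number of ordered trees with $n$ edges, $j$ leaves, and height at most $k$, with the convention that the one-vertex tree (no edges) is counted in $N(0,0,k)$ and has zero leaves for this purpose, so $N(0,0,k)=1$ for all $k\ge 0$. *)

(* Defs.v *)
From HB Require Import structures.
From mathcomp Require Import all_boot.

Set Implicit Arguments.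
Unset Strict Implicit.
Unset Printing Implicit Defensive.

(* [Node s] is the ordered tree whose root has the children subtrees [s], in
   this order. *)
Inductive otree : Type := Node of seq otree.

Definition children (t : otree) : seq otree := let: Node s := t in s.

Lemma otree_ind' (P : otree -> Prop) :
  P (Node [::]) -> (forall t s, P t -> P (Node s) -> P (Node (t :: s))) ->
  forall t, P t.
Proof.
move=> P0 Pcons; fix IHt 1; case.
by elim=> [|t s IHs]; [exact: P0 | exact: Pcons (IHt t) IHs].
Qed.

Fixpoint otree_encode (t : otree) : GenTree.tree void :=
  GenTree.Node 0 (map otree_encode (children t)).

Fixpoint otree_decode (g : GenTree.tree void) : otree :=
  if g is GenTree.Node _ s then Node (map otree_decode s) else Node [::].

Lemma otree_encodeK : cancel otree_encode otree_decode.
Proof. by elim/otree_ind' => [//|t s /= -> [->]]. Qed.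

HB.instance Definition _ := Countable.copy otree (can_type otree_encodeK).

Fixpoint edges (t : otree) : nat :=
  sumn [seq (edges c).+1 | c <- children t].

Fixpoint height (t : otree) : nat :=
  foldr maxn 0 [seq (height c).+1 | c <- children t].

Fixpoint childless (t : otree) : nat :=
  if children t is [::] then 1 else sumn [seq childless c | c <- children t].

(* By convention the one-vertex tree has no leaves, although its root is
   childless. *)
Definition leaves (t : otree) : nat :=
  if t == Node [::] then 0 else childless t.

Definition otree_of (n : nat) : Type := {t : otree | edges t == n}.

HB.instance Definition _ n := SubCountable.on (otree_of n).

(* Contains every ordered tree with at most [m] edges, but also larger ones. *)
Fixpoint otree_upto (m : nat) : seq otree :=
  if m is m'.+1 then
    Node [::] ::
    [seq Node (t :: children u) | t <- otree_upto m', u <- otree_upto m']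
  else [:: Node [::]].

Lemma mem_otree_upto m t : edges t <= m -> t \in otree_upto m.
Proof.
elim/otree_ind': t m => [|t s IHt IHs] [|m] //=; rewrite addSn ltnS => le_m.
rewrite in_cons; apply/orP; right; apply/allpairsP; exists (t, Node s).
split=> //=; first by apply: IHt; apply: leq_trans le_m; apply: leq_addr.
by apply: IHs; apply: leq_trans le_m; apply: leq_addl.
Qed.

Definition otree_of_enum (n : nat) : seq (otree_of n) :=
  undup (pmap insub (otree_upto n)).

Lemma otree_of_enumP n : Finite.axiom (otree_of_enum n).
Proof.
apply: Finite.uniq_enumP; first exact: undup_uniq.
move=> t; rewrite mem_undup mem_pmap_sub /=.
by apply: mem_otree_upto; rewrite (eqP (valP t)).
Qed.

HB.instance Definition _ n := isFinite.Build (otree_of n) (@otree_of_enumP n).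

Definition N (n j k : nat) : nat :=
  #|[set t : otree_of n | (leaves (val t) == j) && (height (val t) <= k)]|.

(* Main.v *)
(* Deleting all leaves of a tree with [n] edges, [j] leaves and height at most
   [k] leaves a tree [s] with [m = n - j] edges and height at most [k - 1].
   Conversely, the tree is recovered from [s] by inserting [j] leaves into the
   [2 * m + 1] gaps around the edges of [s], with at least one leaf attached to
   each of the [i] leaves of [s]. Distributing the remaining [j - i] leaves
   freely gives ['C(j - i + 2 * m, 2 * m)] trees over [s]. *)
Require Import Defs.
From mathcomp Require Import all_boot zify.

Set Implicit Arguments.
Unset Strict Implicit.
Unset Printing Implicit Defensive.

(** * Binomial coefficients as power series coefficients *)

(* The coefficient of [X ^ j] in [X ^ l / (1 - X) ^ p.+1]. *)
Definition shifted_bin (l p j : nat) : nat :=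
  if l <= j then 'C(j - l + p, p) else 0.

Lemma shifted_binSS l p j : shifted_bin l.+1 p j.+1 = shifted_bin l p j.
Proof. by rewrite /shifted_bin ltnS subSS. Qed.

Lemma shifted_bin0 l p q : shifted_bin l p 0 = shifted_bin l q 0.
Proof. by case: l => [|l] //; rewrite /shifted_bin /= !binn. Qed.

(** Pascal's rule, read off from (1 - X) * X^l / (1 - X)^(p+2) = X^l / (1 - X)^(p+1). *)
Lemma shifted_binS l p j :
  shifted_bin l p.+1 j.+1 = shifted_bin l p.+1 j + shifted_bin l p j.+1.
Proof.
rewrite /shifted_bin; case: (leqP l j) => [le_lj | lt_jl].
  by rewrite (leqW le_lj) subSn // addSn binS addSnnS addnC.
case: (leqP l j.+1) => // le_lj; have -> : l = j.+1 by lia.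
by rewrite subnn !binn.
Qed.

(** Multiplying the two series adds the powers of X, and [p + 1] and [q + 1] add up to
    [(p + q).+1 + 1]. The inductions strip the factors X first, then the factors 1 / (1 - X) of the
    first series. *)
Lemma shifted_bin_conv l l' p q j :
  \sum_(0 <= a < j.+1) shifted_bin l p a * shifted_bin l' q (j - a) =
  shifted_bin (l + l') (p + q).+1 j.
Proof.
elim: l j => [|l IHl] j; last first.
  case: j => [|j]; first by rewrite big_nat1.
  rewrite big_nat_recl //= addSn shifted_binSS -IHl.
  by apply: eq_bigr => a _; rewrite shifted_binSS subSS.
elim: l' j => [|l' IHl'] j; last first.
  case: j => [|j]; first by rewrite big_nat1 muln0.
  rewrite big_nat_recr //= subnn muln0 addn0 shifted_binSS -IHl'.
  by apply: eq_big_nat => a /andP[_ lt_aj]; rewrite subSn ?shifted_binSS.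
elim: p j => [|p IHp] j; last first.
  elim: j => [|j IHj]; first by rewrite big_nat1 /shifted_bin /= !binn.
  rewrite big_nat_recl //= addSn shifted_binS -[(p + q).+2]/(p.+1 + q).+1 -IHj.
  rewrite -IHp.
  rewrite [X in _ = _ + X]big_nat_recl // addnCA; congr (_ + _).
    by rewrite (shifted_bin0 _ p.+1 p).
  rewrite -big_split /=; apply: eq_bigr => a _.
  by rewrite shifted_binS mulnDl subSS.
(* For [p = 0] every first factor is 1, so the convolution is a partial sum that gains one term per
   step, as in Pascal's rule. *)
elim: j => [|j IHj]; first by rewrite big_nat1 /shifted_bin /= !binn.
rewrite big_nat_recl //= shifted_binS -IHj addnC subn0.
congr (_ + _); last by rewrite /shifted_bin bin0 mul1n.
by apply: eq_bigr => a _; rewrite subSS /shifted_bin !bin0.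
Qed.

(** * Deleting all leaves of a tree *)

Notation leaf := (Node [::]).

(** The root always survives, so the one-vertex tree prunes to itself, in accordance with its having
    no leaves. *)
Fixpoint prune (t : otree) : otree :=
  Node (foldr (fun c r => if children c is [::] then r else prune c :: r)
              [::] (children t)).
Arguments prune : simpl never.

Lemma prune_leaf_cons u : prune (Node (leaf :: u)) = prune (Node u).
Proof. by []. Qed.

Lemma prune_cons x u : x != leaf ->
  prune (Node (x :: u)) = Node (prune x :: children (prune (Node u))).
Proof. by case: x => [[]]. Qed.

Lemma childlessE t : childless t = (t == leaf) + leaves t.
Proof. by rewrite /leaves; case: eqP => [->|]. Qed.

Lemma node_cons_neq_leaf x u : (Node (x :: u) == leaf) = false.
Proof. exact/eqP. Qed.

Lemma leaves_cons x u :
  leaves (Node (x :: u)) = childless x + leaves (Node u).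
Proof.
by case: u => [|y u]; rewrite /leaves ?eqxx !node_cons_neq_leaf.
Qed.

Lemma leaves_eq0 t : (leaves t == 0) = (t == leaf).
Proof.
elim/otree_ind': t => [|t s IHt _]; first by rewrite /leaves eqxx.
by rewrite leaves_cons childlessE -IHt node_cons_neq_leaf; case: (leaves t).
Qed.

Lemma childless_gt0 t : 0 < childless t.
Proof. by rewrite childlessE -leaves_eq0; case: leaves. Qed.

Lemma leaves_le_edges t : leaves t <= edges t.
Proof.
elim/otree_ind': t => // t s IHt IHs.
rewrite leaves_cons childlessE.
by move: IHt IHs => /= IHt IHs; case: (_ == _); lia.
Qed.

Lemma edges_prune t : edges (prune t) + leaves t = edges t.
Proof.
elim/otree_ind': t => // t s IHt IHs; rewrite leaves_cons.
have [-> | t_nleaf] := eqVneq t leaf.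
  by rewrite prune_leaf_cons; move: IHs => /=; lia.
rewrite prune_cons // childlessE (negbTE t_nleaf); move: IHt IHs => /=; lia.
Qed.

Lemma height_eq0 t : (height t == 0) = (t == leaf).
Proof. by case: t => [[|x u]]; rewrite ?eqxx ?node_cons_neq_leaf //=; lia. Qed.

Lemma height_prune t : height (prune t) = (height t).-1.
Proof.
elim/otree_ind': t => // t s IHt IHs.
have [-> | t_nleaf] := eqVneq t leaf.
  by rewrite prune_leaf_cons IHs /=; lia.
rewrite prune_cons //; move: IHt IHs t_nleaf; rewrite -height_eq0 /= ?eqSS; lia.
Qed.

(** Base case of the fibers: only stars prune to a single vertex. *)
Lemma prune_eq_leaf t j :
  (prune t == leaf) && (leaves t == j) = (t == Node (nseq j leaf)).
Proof.
elim/otree_ind': t j => [j|t s _ IHs j].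
  by case: j => [|j]; rewrite /leaves !eqxx //; apply/esym/eqP.
rewrite leaves_cons; have [-> | t_nleaf] := eqVneq t leaf.
  rewrite prune_leaf_cons; case: j => [|j].
    by rewrite node_cons_neq_leaf andbF.
  by rewrite eqSS IHs; apply/eqP/eqP => [[->]|[->]].
rewrite prune_cons // node_cons_neq_leaf; case: j => [|j]; apply/esym/eqP => //.
by case=> t_leaf; rewrite t_leaf eqxx in t_nleaf.
Qed.

(** * Fibers of pruning, enumerated recursively *)

Definition cons_tree (x u : otree) : otree := Node (x :: children u).

Lemma cons_tree_inj2 x u x' u' :
  cons_tree x u = cons_tree x' u' -> x = x' /\ u = u'.
Proof. by case: u u' => [u] [u'] [-> ->]. Qed.

(* By first subtree: either it is a leaf, or it prunes to [c]. The latter has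
   at least one leaf, whence the range of [a]. *)
Fixpoint cons_fiber (Lc Ls : nat -> seq otree) (j : nat) : seq otree :=
  (if j is j'.+1 then map (cons_tree leaf) (cons_fiber Lc Ls j') else [::]) ++
  [seq cons_tree p.1 p.2
     | a <- iota 1 j, p <- [seq (x, u) | x <- Lc a, u <- Ls (j - a)]].

(** Duplicate-free lists stand in for finite sets, so that fibers inside the infinite type [otree]
    can be counted by [size]. *)
Definition is_fiber (s : otree) (L : nat -> seq otree) : Prop :=
  forall j, uniq (L j) /\
    forall t, (t \in L j) = (prune t == s) && (leaves t == j).

Section ConsFiber.

Variables (c : otree) (s : seq otree) (Lc Ls : nat -> seq otree).
Hypotheses (fiberLc : is_fiber c Lc) (fiberLs : is_fiber (Node s) Ls).

(** A tree over [Node (c :: s)] begins with a run of leaf children; [ends] collects the trees where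
    this run is empty. *)
Let ends j := [seq cons_tree p.1 p.2
  | a <- iota 1 j, p <- [seq (x, u) | x <- Lc a, u <- Ls (j - a)]].

Lemma cons_fiberS j : cons_fiber Lc Ls j.+1 =
  map (cons_tree leaf) (cons_fiber Lc Ls j) ++ ends j.+1.
Proof. by []. Qed.

Lemma mem_ends j x u : (Node (x :: u) \in ends j) =
  [&& x != leaf, prune x == c, prune (Node u) == Node s &
      leaves x + leaves (Node u) == j].
Proof.
apply/allpairsPdep/and4P.
  move=> [a [_ [a_in /allpairsP[[x' u'] /= [x'_in u'_in ->]]]]] /=.
  move=> [-> ->]; rewrite mem_iota in a_in.
  have -> : Node (children u') = u' by case: u' {u'_in}.
  move: x'_in u'_in; rewrite (fiberLc _).2 (fiberLs _).2.
  move=> /andP[-> /eqP def_a] /andP[-> /eqP->].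
  by rewrite -leaves_eq0 def_a; split=> //; lia.
move=> [x_nleaf prune_x prune_u /eqP def_j].
exists (leaves x), (x, Node u); split=> //.
  by rewrite mem_iota; move: x_nleaf; rewrite -leaves_eq0; lia.
apply: allpairs_f; first by rewrite (fiberLc _).2 prune_x eqxx.
by rewrite (fiberLs _).2 prune_u; lia.
Qed.

Lemma leaf_notin_ends j : leaf \notin ends j.
Proof. by apply/negP => /allpairsPdep[a [p [_ _]]]. Qed.

Lemma uniq_ends j : uniq (ends j).
Proof.
apply: allpairs_uniq_dep => [|a _|]; first exact: iota_uniq.
  apply: allpairs_uniq; [exact: (fiberLc _).1 | exact: (fiberLs _).1 |].
  by move=> [? ?] [? ?] _ _.
(* The index [a] can be recovered as the number of leaves of the first subtree, so different [a]
   give disjoint blocks. *)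
have tag_leaves (p : {a : nat & (otree * otree)%type}) :
    p \in [seq existT (fun=> (otree * otree)%type) a q | a <- iota 1 j,
             q <- [seq (x, u) | x <- Lc a, u <- Ls (j - a)]] ->
    tag p = leaves (tagged p).1.
  move=> /allpairsPdep[a [_ [_ /allpairsP[[x u] /= [x_in _ ->]] ->]]] /=.
  by move: x_in; rewrite (fiberLc _).2 => /andP[_ /eqP->].
move=> p q /tag_leaves + /tag_leaves; case: p q => [a [x u]] [b [y v]] /=.
by move=> -> -> /cons_tree_inj2[-> ->].
Qed.

Lemma is_fiber_cons : is_fiber (Node (c :: s)) (cons_fiber Lc Ls).
Proof.
elim=> [|j [uniqL memL]].
  split=> // -[[|x u]]; first by apply/esym/negP => /andP[/eqP].
  rewrite in_nil leaves_cons; apply/esym/negP => /andP[_].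
  by rewrite addn_eq0 eqn0Ngt childless_gt0.
rewrite cons_fiberS.
split=> [|t].
  rewrite cat_uniq uniq_ends andbT.
  rewrite map_inj_uniq ?uniqL => [|u v /cons_tree_inj2[]//].
  by apply/hasPn => -[[|x u]]; rewrite ?(negbTE (leaf_notin_ends _)) // mem_ends
     => /and4P[x_nleaf _ _ _]; apply/mapP => -[v _ [x_leaf _]];
     rewrite x_leaf in x_nleaf.
rewrite mem_cat; case: t => [[|x u]].
  rewrite (negbTE (leaf_notin_ends _)) orbF.
  have -> : (prune leaf == Node (c :: s)) = false by exact/eqP.
  by apply/mapP => -[].
rewrite mem_ends leaves_cons childlessE; have [-> | x_nleaf] := eqVneq x leaf.
  rewrite prune_leaf_cons eqSS -memL orbF.
  apply/mapP/idP => [[[v] v_in [->]] //|u_in]; by exists (Node u).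
rewrite prune_cons //; case: mapP => [[v _ [x_leaf _]]|_].
  by rewrite x_leaf in x_nleaf.
case: (prune (Node u)) => v /=; rewrite andbA; congr (_ && _).
by apply/andP/eqP => [[/eqP-> /eqP[->]] | [-> ->]].
Qed.

(** The non-leaf first subtree and the remaining siblings contribute the product of their series,
    and the run of leaves before them one more factor 1 / (1 - X). *)
Lemma size_cons_fiber lc pc ls ps :
  (forall j, 0 < j -> size (Lc j) = shifted_bin lc.+1 pc j) ->
  (forall j, size (Ls j) = shifted_bin ls ps j) ->
  forall j, size (cons_fiber Lc Ls j) = shifted_bin (lc.+1 + ls) (pc + ps).+2 j.
Proof.
move=> szLc szLs j.
have szE i : size (ends i) = shifted_bin (lc.+1 + ls) (pc + ps).+1 i.
  rewrite size_allpairs_dep sumnE big_map -shifted_bin_conv big_ltn //.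
  (* The term [a = 0], absent from [ends], vanishes because of the shift [lc.+1]. *)
  rewrite [X in _ = X + _]mul0n add0n -{1}[i]subn0 -subSS -/(index_iota 1 i.+1).
  apply: eq_big_nat => a /andP[a_gt0 _].
  by rewrite size_allpairs szLc ?szLs.
elim: j => [//|j IHj].
rewrite cons_fiberS.
by rewrite size_cat size_map IHj szE -shifted_binS.
Qed.

End ConsFiber.

Lemma fiber_exists s : exists L, is_fiber s L /\
  forall j, size (L j) = shifted_bin (leaves s) (2 * edges s) j.
Proof.
elim/otree_ind': s => [|c s [Lc [fibLc szLc]] [Ls [fibLs szLs]]].
  exists (fun j => [:: Node (nseq j leaf)]); split=> j; last first.
    by rewrite /shifted_bin /= bin0.
  by split=> // t; rewrite inE prune_eq_leaf.
exists (cons_fiber Lc Ls); split=> [|j]; first exact: is_fiber_cons.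
rewrite (size_cons_fiber (Lc := Lc) (lc := (childless c).-1)
           (pc := 2 * edges c) _ szLs) => [|{}j j_gt0].
  rewrite prednK ?childless_gt0 // leaves_cons; congr shifted_bin.
  by rewrite /= -/(edges (Node s)); lia.
rewrite prednK ?childless_gt0 // szLc childlessE.
(* A leaf [c] has [leaves c = 0] but must receive a leaf below it, hence the shift 1; for positive
   [j] both coefficients are 1. *)
by have [-> | //] := eqVneq c leaf; rewrite /shifted_bin j_gt0 /= !bin0.
Qed.

(** * Counting trees by their pruning *)

Lemma card_fiber n m (s : otree_of m) j : n = m + j ->
  #|[set t : otree_of n | (prune (val t) == val s) && (leaves (val t) == j)]| =
  'C(2 * m + j - leaves (val s), 2 * m).
Proof.
move=> def_n; have [L [fibL szL]] := fiber_exists (val s).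
have edges_s : edges (val s) = m by exact/eqP/(valP s).
transitivity (size (L j)); last first.
  rewrite szL edges_s /shifted_bin; case: leqP => [le_j | lt_j].
    by congr 'C(_, _); lia.
  (* Here [j < leaves s <= m] forces [0 < m], so even with truncated subtraction the upper entry is
     below [2 * m] and the binomial is 0. *)
  have := leaves_le_edges (val s); rewrite edges_s => le_m.
  by rewrite bin_small //; lia.
rewrite cardE -(size_map val); apply/perm_size/uniq_perm.
- by rewrite map_inj_uniq ?enum_uniq //; exact: val_inj.
- exact: (fibL j).1.
move=> t; rewrite (fibL j).2; apply/mapP/idP => [[{}t + ->]|].
  by rewrite mem_enum inE.
move=> t_in; have edges_t : edges t == n.
  move: t_in => /andP[/eqP prune_t /eqP leaves_t].
  by rewrite -edges_prune prune_t leaves_t edges_s def_n.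
by exists (exist _ t edges_t) => //; rewrite mem_enum inE.
Qed.

Lemma N_fiberwise n m j k : 0 < j -> n = m + j ->
  N n j k.+1 = \sum_(s : otree_of m | height (val s) <= k)
                 'C(2 * m + j - leaves (val s), 2 * m).
Proof.
move=> j_gt0 def_n.
under eq_bigr => s _ do
  rewrite -(card_fiber s def_n) cardsE -sum1_card big_mkcond /=.
(* Summed in the other order, each [t] with [j] leaves meets only [s = prune t], so the inner sum is
   1 or 0 according to the height. *)
rewrite exchange_big /N cardsE -sum1_card big_mkcond /=.
apply: eq_bigr => t _; rewrite !unfold_in.
under [RHS]eq_bigr do rewrite unfold_in.
have [leaves_t | _] /= := eqVneq (leaves (val t)) j; last first.
  by rewrite big1 // => s _; rewrite andbF.
have prune_in : edges (prune (val t)) == m.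
  by have := edges_prune (val t); rewrite (eqP (valP t)); lia.
pose s0 : otree_of m := exist _ (prune (val t)) prune_in.
rewrite -big_mkcondr /=
  (eq_bigl (fun s => (height (val t) <= k.+1) && (s == s0))).
  by case: ifP => _; [rewrite big_pred1_eq | rewrite big_pred0].
move=> s; rewrite andbT eq_sym -[s == s0]val_eqE /=.
case: eqVneq => [-> | _]; last by rewrite !andbF.
by rewrite height_prune !andbT; lia.
Qed.

Lemma N_recurrence n m j k : 0 < j -> n = m + j ->
  N n j k.+1 = \sum_(0 <= i < m.+1) N m i k * 'C(2 * m + j - i, 2 * m).
Proof.
move=> j_gt0 def_n; rewrite (N_fiberwise _ j_gt0 def_n) big_mkord.
have leaves_lt (s : otree_of m) : leaves (val s) < m.+1.
  by rewrite ltnS -[X in _ <= X](eqP (valP s)) leaves_le_edges.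
(* The binomial depends on [s] only through its number of leaves, which is at most [m]. *)
rewrite (partition_big (fun s => Ordinal (leaves_lt s)) predT) //=.
apply: eq_bigr => i _; rewrite /N cardsE -sum_nat_const.
by apply: eq_big => [s | s /andP[_ /eqP<-] //]; rewrite unfold_in andbC.
Qed.

Theorem theorem16 (n j k : nat) (hk : 1 <= k) (hj : 1 <= j) (hjn : j <= n) :
  N n j k = \sum_(0 <= i < (n - j).+1)
              N (n - j) i (k - 1) * 'C(2 * n - j - i, 2 * n - 2 * j)
  /\
  N n j k = \sum_(0 <= i < (n - j).+1)
              N (n - j) (n - j - i) (k - 1) * 'C(n + i, 2 * n - 2 * j).
Proof.
case: k hk => // k _; rewrite subn1 /= (N_recurrence k hj (esym (subnK hjn))).
(* The second form is the first with the order of summation reversed. *)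
split; last rewrite big_nat_rev; apply: eq_big_nat => i /andP[_ lt_i].
  by congr (_ * 'C(_, _)); lia.
by congr (N _ _ _ * 'C(_, _)); lia.
Qed.
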